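(* Let $\mathcal{H}$ be a Hilbert space, let $A,B\in\mathcal{B}(\mathcal{H})$ be self-adjoint operators with spectra contained in the interval $J$, and let $f\in C^1_{\mathrm{co}}(J)$. Then $$f(B)\le f(A)+\gamma\,\mathbf{1}_{\mathcal{H}},$$ where $$\gamma=\sup_{x\in\mathcal{H},\ \|x\|=1}\left\{\langle f'(B)Bx,x\rangle-\langle Ax,x\rangle\langle f'(B)x,x\rangle\right\}.$$
   Context: $\mathcal{B}(\mathcal{H})$ is the $C^*$-algebra of bounded linear operators on a (complex) Hilbert space $\mathcal{H}$, with identity $\mathbf{1}_{\mathcal{H}}$. An operator $A$ is positive ($A\ge 0$) if $\langle Ax,x\rangle\ge 0$ for all $x\in\mathcal{H}$; for self-adjoint $A,B$, $A\le B$ means $B-A\ge 0$. $C^1_{\mathrm{co}}(J)$ denotes the class of differentiable convex real functions on the interval $J\subseteq\mathbb{R}$ (one-sided derivatives at endpoints belonging to $J$); $f'$ is the derivative of $f$. For a self-adjoint operator $T$ with spectrum in $J$, $f(T)$ and $f'(T)$ are defined by the continuous functional calculus. *)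

(* Defs.v *)
From HB Require Import structures.
From mathcomp Require Import all_boot all_order all_algebra.
From mathcomp Require Import complex.
From mathcomp Require Import all_classical all_reals all_analysis.

Set Implicit Arguments.
Unset Strict Implicit.
Unset Printing Implicit Defensive.

Import Order.TTheory GRing.Theory Num.Theory.
Import numFieldNormedType.Exports.

Local Open Scope classical_set_scope.
Local Open Scope ring_scope.
Local Open Scope complex_scope.

(* A complex Hilbert space is a complete normed space H over R[i] together with
   a form dot : {dot H for Num.conj}, linear in its first argument, such that
   `|x| ^+ 2 = dot x x for all x. *)

Section Operators.
Variables (R : realType) (H : completeNormedModType R[i]).
Implicit Types S T : H -> H.

Definition bounded_op T := linear T /\ continuous T.

Definition spectrum T : set R[i] :=
  [set z | ~ exists S, [/\ bounded_op S,
    forall x, S (T x - z *: x) = x & forall x, T (S x) - z *: S x = x]].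

Definition spectrum_in T (J : set R) :=
  spectrum T `<=` [set t%:C | t in J].

Definition poly_op (p : {poly R}) T : H -> H :=
  fun x => \sum_(i < size p) (p`_i)%:C *: iter i T x.

(* Continuous functional calculus of a self-adjoint T: S = f(T) is the limit in
   operator norm of p(T) for real polynomials p tending to f uniformly on the
   spectrum of T. For self-adjoint T and f continuous on the spectrum there is
   exactly one such S. *)
Definition is_cfc T (f : R -> R) S :=
  bounded_op S /\
  forall e : R, 0 < e -> exists p : {poly R},
    (forall t, spectrum T t%:C -> `|p.[t] - f t| <= e) /\
    (forall x, `|S x - poly_op p T x| <= e%:C * `|x|).

Definition cfc (f : R -> R) T : H -> H := xget (fun=> 0) (is_cfc T f).

Variable dot : {dot H for Num.conj}.

Definition selfadjoint T :=
  bounded_op T /\ forall x y, dot (T x) y = dot x (T y).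

(* The order of R[i] makes 0 <= z say that z is real and nonnegative. *)
Definition positive_op T := forall x, 0 <= dot (T x) x.

Definition op_le S T := positive_op (fun x => T x - S x).

End Operators.

Section Differentiability.
Variable R : realType.
Implicit Types (J : set R) (f : R -> R).

(* Difference quotients only use points of J, so the derivative at an endpoint
   of J belonging to J is the one-sided one. *)
Definition derivable_in J f x :=
  cvg ((f y - f x) / (y - x) @[y --> within J x^']).

Definition derive_in J f (x : R) : R :=
  lim ((f y - f x) / (y - x) @[y --> within J x^']).

(* The derivative of a differentiable convex function on an interval is
   automatically continuous. *)
Definition C1co J f :=
  @convex_function R R^o J f /\
  (forall x, J x -> derivable_in J f x).

End Differentiability.

(* Main.v *)
(* For t in sp(B) and s in J convexity gives f(t) <= f(s) + f'(t)(t - s), so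
   f(B) <= f(s) + f'(B)B - s f'(B). At s = <Ax, x>, which lies in J, f(s)
   is bounded by Jensen's inequality f(<Ax, x>) <= <f(A)x, x>, itself the tangent
   inequality at s applied to A.
   The functional calculus needs: p >= 0 on sp(T) implies p(T) >= 0. If m is the
   infimum of the numerical range of p(T), then p(T) - m is not bounded below,
   so one of its factors T - z is not, whence z is in sp(T) and m = p(z). *)
Require Import Defs.
From HB Require Import structures.
From mathcomp Require Import all_boot all_order all_algebra.
From mathcomp Require Import complex.
From mathcomp Require Import all_classical all_reals all_analysis.
From mathcomp Require Import ring lra.

Set Implicit Arguments.
Unset Strict Implicit.
Unset Printing Implicit Defensive.

Import Order.TTheory GRing.Theory Num.Theory.
Import numFieldNormedType.Exports.

Local Open Scope classical_set_scope.
Local Open Scope ring_scope.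
Local Open Scope complex_scope.

(** [cfc] is a norm limit of polynomials, so existence rests on the bound of p(T) by the supremum of
    |p| on the spectrum, which is positivity of e^2 - p^2, together with Weierstrass approximation.
    [J] need be neither closed nor bounded, so the approximation takes place on a segment [m, M]
    whose endpoints are themselves spectral and hence lie in [J]. Both continuity of f and of f' on
    that segment are required. The bridge from quadratic forms to norms is Cauchy-Schwarz for the
    form of a positive operator D: if <Du, u> <= k |u|^2 for all u, then |Dx|^2 <= k <Dx, x>. It
    shows that D is not bounded below when its form comes arbitrarily close to 0 on unit vectors,
    and it yields the contraction that inverts D when its form stays away from 0. The algebraic
    rules concern the relation [is_cfc] rather than the chosen operator [cfc], so sums and products
    are never identified with a chosen value. A unit vector is carried along because on the zero
    space the spectrum is empty. *)

(** * Bernstein polynomials and their second moment *)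

Section Bernstein.
Variable R : realType.
Implicit Types (n : nat) (g h : nat -> R) (x : R).

(* [bernstein n g] is the sum over k <= n of g(k) C(n, k) X^k (1 - X)^(n - k);
   the recursion makes all the identities below one-line inductions. *)
Fixpoint bernstein n g : {poly R} :=
  if n is m.+1 then (1 - 'X) * bernstein m g + 'X * bernstein m (g \o succn)
  else (g 0%N)%:P.

Lemma bernsteinS n g x : (bernstein n.+1 g).[x] =
  (1 - x) * (bernstein n g).[x] + x * (bernstein n (g \o succn)).[x].
Proof. by rewrite /= !hornerE. Qed.

Lemma bernstein_le n g h x : 0 <= x <= 1 ->
  (forall k, (k <= n)%N -> g k <= h k) ->
  (bernstein n g).[x] <= (bernstein n h).[x].
Proof.
move=> /andP[x0 x1]; elim: n g h => [|n IHn] g h gh.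
  by rewrite /= !hornerC gh.
rewrite !bernsteinS lerD// ler_wpM2l ?subr_ge0//.
- by apply: IHn => k kn; apply: gh; rewrite ltnW.
- by apply: IHn => k kn; apply: gh.
Qed.

Lemma bernstein_lin n g h (a b x : R) :
  (bernstein n (fun k => a * g k + b * h k)).[x] =
  a * (bernstein n g).[x] + b * (bernstein n h).[x].
Proof.
elim: n g h => [|n IHn] g h; first by rewrite /= !hornerC.
rewrite !bernsteinS IHn (IHn (g \o succn) (h \o succn)); ring.
Qed.

Lemma bernstein_cst n (c x : R) : (bernstein n (fun=> c)).[x] = c.
Proof.
elim: n => [|n IHn]; first by rewrite /= hornerC.
rewrite bernsteinS [_ \o _](_ : _ = fun=> c) ?IHn; first by ring.
exact/funext.
Qed.

(** Second moment about c of the binomial law: squared bias plus variance. Leaving c free closes the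
    induction, since shifting the index replaces c by c - 1. *)
Lemma bernstein_sqr n (c x : R) :
  (bernstein n (fun k => (k%:R - c) ^+ 2)).[x] =
  (n%:R * x - c) ^+ 2 + n%:R * x * (1 - x).
Proof.
elim: n c => [|n IHn] c; first by rewrite /= hornerC; ring.
rewrite bernsteinS IHn [_ \o _](_ : _ = fun k => (k%:R - (c - 1)) ^+ 2).
  by rewrite IHn -natr1; ring.
by apply/funext => k /=; rewrite -natr1; ring.
Qed.

End Bernstein.

(** * Weierstrass approximation on a segment *)

Section Weierstrass.
Variable R : realType.
Implicit Types (f : R -> R) (a b e : R).

(* A uniform modulus of continuity in quadratic form, so that it can be
   integrated against the variance of the Bernstein weights. *)
Lemma continuous_quad_modulus f a b e : {within `[a, b], continuous f} ->
  0 < e -> exists2 C : R, 0 <= C &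
    forall s t, s \in `[a, b] -> t \in `[a, b] ->
      `|f s - f t| <= e + C * (s - t) ^+ 2.
Proof.
move=> cf e0; have [ba|ab] := ltP b a.
  exists 0 => // s t; rewrite in_itv/= => /andP[as_ sb].
  by have := lt_le_trans ba (le_trans as_ sb); rewrite ltxx.
have [B B0 fB] : exists2 B : R, 0 <= B & forall t, t \in `[a, b] -> `|f t| <= B.
  have [c1 _ f1] := EVT_max ab cf; have [c2 _ f2] := EVT_min ab cf.
  exists (`|f c1| + `|f c2|) => [|t tab]; first by rewrite addr_ge0.
  have := f1 _ tab; have := f2 _ tab; have := ler_norm (f c1).
  have := ler_norm (- f c2); rewrite normrN.
  move=> ? ? ? ?; have := normr_ge0 (f c1); have := normr_ge0 (f c2).
  by rewrite ler_norml => ? ?; apply/andP; split; lra.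
(* Compactness turns a threshold for C valid near each point into one valid on the whole segment. *)
have : \forall C \near +oo, `[a, b]%classic `<=`
    (fun t => forall s, s \in `[a, b] -> `|f s - f t| <= e + C * (s - t) ^+ 2).
  apply: (near_covering_withinP _).2.
    by apply/compact_near_coveringP; exact: segment_compact.
  move=> x xab.
  have /subspace_continuousP/(_ x xab)/cvgrPdist_lt/(_ (e / 2)) := cf.
  move=> /(_ (divr_gt0 e0 (ltr0n _ 2))).
  rewrite near_withinE => /nbhs_ballP[d /= d0 fd].
  (* If s is within d of x, continuity at x suffices. Otherwise |s - t| >= d / 2, and for these C
     the quadratic term alone exceeds the trivial bound 2B. *)
  exists (ball x (d / 2), [set C : R | 2 * B / (d / 2) ^+ 2 <= C]).
    split => /=; first by apply: nbhsx_ballx; rewrite divr_gt0.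
    by apply: nbhs_pinfty_ge; rewrite num_real.
  move=> [t C] /= [xt CB] tab s sab.
  have d20 : 0 < d / 2 by rewrite divr_gt0.
  have C0 : 0 <= C by rewrite (le_trans _ CB)// divr_ge0 ?sqr_ge0// mulr_ge0.
  have sqr_ge : 0 <= C * (s - t) ^+ 2 by rewrite mulr_ge0 ?sqr_ge0.
  have [sx|sx] := ltP `|x - s| d.
    rewrite (le_trans (ler_distD (f x) _ _))// (distrC (f s)).
    have tx : `|x - t| < d by move: xt; rewrite /ball/=; lra.
    have := fd s sx sab; have := fd t tx tab; lra.
  rewrite (le_trans (ler_normB _ _))//.
  have := fB _ sab; have := fB _ tab => ? ?.
  suff : 2 * B <= C * (s - t) ^+ 2 by lra.
  move: CB; rewrite ler_pdivrMr ?exprn_gt0// => CB.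
  rewrite (le_trans CB)// ler_wpM2l// -(real_normK (num_real (s - t))).
  rewrite ler_sqr ?nnegrE ?(ltW d20)//.
  have := ler_distD t x s; rewrite (distrC t s); move: xt; rewrite /ball/=.
  lra.
move=> /pinfty_ex_gt0[C C0 fC]; exists C; first exact: ltW.
by move=> s t sab tab; apply: fC.
Qed.

Theorem weierstrass_approximation f a b e :
  {within `[a, b], continuous f} -> 0 < e ->
  exists p : {poly R}, forall t, t \in `[a, b] -> `|p.[t] - f t| <= e.
Proof.
move=> cf e0; have [ba|] := ltP b a.
  exists 0 => t; rewrite in_itv/= => /andP[at_ tb].
  by have := lt_le_trans ba (le_trans at_ tb); rewrite ltxx.
rewrite le_eqVlt => /predU1P[<-|ab].
  exists (f a)%:P => t; rewrite in_itv/= -eq_le => /eqP <-.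
  by rewrite hornerC subrr normr0 ltW.
have [C C0 fC] := continuous_quad_modulus cf (divr_gt0 e0 (ltr0n _ 2)).
pose L := b - a; have L0 : 0 < L by rewrite subr_gt0.
(* The variance contributes C L^2 x (1 - x) / N to the error, so this N keeps it below e / 2. *)
have [n nC] : exists n : nat, C * L ^+ 2 <= e / 2 * n.+1%:R.
  exists (Num.bound (C * L ^+ 2 / (e / 2))).
  rewrite -ler_pdivrMl ?divr_gt0// mulrC ltW//.
  rewrite (lt_trans (archi_boundP _)) ?ltr_nat//.
  by rewrite divr_ge0 ?mulr_ge0 ?sqr_ge0 ?divr_ge0// ltW.
pose N : R := n.+1%:R; have N0 : 0 < N by rewrite ltr0n.
pose g k := f (a + L * (k%:R / N)).
exists (bernstein n.+1 g \Po (L^-1 *: ('X - a%:P))) => t tab.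
rewrite horner_comp hornerZ hornerXsubC.
set x := _ * (t - a); have xt : t = a + L * x.
  by rewrite /x mulrA divff ?gt_eqF// mul1r addrC subrK.
clearbody x.
have x01 : 0 <= x <= 1.
  move: tab; rewrite in_itv/= xt -lerBlDl subrr pmulr_rge0// -lerBrDl.
  by rewrite ger_pMr.
have gk k : (k <= n.+1)%N ->
    `|g k - f t| <= e / 2 + C * L ^+ 2 / N ^+ 2 * (k%:R - N * x) ^+ 2.
  move=> kn; rewrite (le_trans (fC _ t _ tab))//.
    rewrite in_itv/= lerDl -lerBrDl mulr_ge0 ?divr_ge0 ?(ltW L0) ?(ltW N0)//=.
    by rewrite ger_pMr// ler_pdivrMr// mul1r ler_nat.
  rewrite lerD2l xt le_eqVlt; apply/orP; left; apply/eqP.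
  by field; rewrite gt_eqF.
have var : C * L ^+ 2 / N ^+ 2 * (N * x * (1 - x)) <= e / 2.
  rewrite (_ : _ * _ = C * L ^+ 2 / N * (x * (1 - x))); last first.
    by field; rewrite gt_eqF.
  move: nC; rewrite -ler_pdivrMr// => nC.
  rewrite -[leRHS]mulr1 ler_pM ?divr_ge0 ?mulr_ge0 ?sqr_ge0 ?(ltW N0)//; nra.
(* Evaluates the upper (s = 1) and lower (s = -1) envelopes of [g]; monotonicity then traps the
   Bernstein polynomial of [g] between them. The factors 1 are there to match [bernstein_lin]. *)
have bE (s : R) : (bernstein n.+1 (fun k => 1 * f t +
      s * (e / 2 * 1 + C * L ^+ 2 / N ^+ 2 * (k%:R - N * x) ^+ 2))).[x]
   = f t + s * (e / 2 + C * L ^+ 2 / N ^+ 2 * (N * x * (1 - x))).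
  rewrite bernstein_lin bernstein_lin !bernstein_cst bernstein_sqr.
  by rewrite subrr expr0n add0r mulr1 mul1r.
rewrite ler_distl; apply/andP; split.
- apply: (@le_trans _ _ (f t + -1 * (e / 2 + C * L ^+ 2 / N ^+ 2 * (N * x * (1 - x))))).
    by rewrite mulN1r lerD2l lerN2 [leRHS]splitr lerD2l.
  rewrite -bE; apply: bernstein_le => // k /gk; rewrite ler_distl mulr1.
  by rewrite mul1r mulN1r => /andP[].
- apply: (@le_trans _ _ (f t + 1 * (e / 2 + C * L ^+ 2 / N ^+ 2 * (N * x * (1 - x))))).
    rewrite -bE; apply: bernstein_le => // k /gk; rewrite ler_distl mulr1.
    by rewrite !mul1r => /andP[].
  by rewrite mul1r lerD2l [leRHS]splitr lerD2l.
Qed.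
End Weierstrass.

(** * Tangents and continuity of the derivative of a convex function *)

Section ConvexDerivative.
Variable R : realType.
Implicit Types (J : set R) (f g : R -> R).

Lemma convex_functionE J f (t x y : R) : @convex_function R R^o J f ->
  J x -> J y -> 0 <= t <= 1 ->
  f (t * x + (1 - t) * y) <= t * f x + (1 - t) * f y.
Proof.
move=> cf Jx Jy /andP[t0 t1].
by have /= := cf (Itv01 t0 t1) x y; rewrite !inE => /(_ Jx Jy).
Qed.

(** Free of division and with a free slope l, so that it transfers directly to the reflected
    function. *)
Definition deriv_at J f x (l : R) := forall e : R, 0 < e ->
  exists2 d : R, 0 < d & forall y, J y -> y != x -> `|y - x| < d ->
    `|f y - f x - l * (y - x)| <= e * `|y - x|.

Lemma derive_inP J f x : derivable_in J f x -> deriv_at J f x (derive_in J f x).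
Proof.
move=> /cvgrPdist_lt df e /df; rewrite /dnbhs !near_withinE.
move=> /nbhs_ballP[d /= d0 fd]; exists d => // y Jy yx yd.
rewrite -subr_eq0 in yx; rewrite -ler_pdivrMr ?normr_gt0// -normf_div.
have := fd y _ _ Jy; rewrite -subr_eq0 => /(_ _ yx) => fdy.
rewrite mulrBl mulfK// distrC ltW//.
by apply: fdy; rewrite /ball/= distrC.
Qed.

Lemma deriv_at_continuous J f x l : J x -> deriv_at J f x l ->
  forall e : R, 0 < e -> exists2 d : R, 0 < d &
    forall y, J y -> `|y - x| < d -> `|f y - f x| < e.
Proof.
move=> Jx df e e0; have [d d0 fd] := df 1 ltr01.
pose c := `|l| + 1; have c0 : 0 < c by rewrite ltr_wpDl.
exists (Num.min d (e / c)); first by rewrite lt_min d0 divr_gt0.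
move=> y Jy; rewrite lt_min => /andP[yd ye].
have [->|yx] := eqVneq y x; first by rewrite subrr normr0.
have := fd y Jy yx yd; move: ye; rewrite ltr_pdivlMr// => ye.
have := ler_normD (f y - f x - l * (y - x)) (l * (y - x)).
rewrite subrK normrM => h1 h2.
by move: ye; rewrite /c mulrDr mulr1; lra.
Qed.

Lemma itv_combo J x y t : is_interval J -> J x -> J y -> 0 <= t <= 1 ->
  J (x + t * (y - x)).
Proof.
move=> iJ Jx Jy /andP[t0 t1]; have [xy|yx] := leP x y.
  by apply: (iJ _ _ Jx Jy); apply/andP; split; nra.
by apply: (iJ _ _ Jy Jx); apply/andP; split; nra.
Qed.

Lemma small_step (d x y : R) : 0 < d ->
  exists2 s, 0 < s < 1 & `|s * (y - x)| < d.
Proof.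
move=> d0; pose c := `|y - x| + d; have c0 : 0 < c by rewrite ltr_wpDl.
exists (d / (2 * c)).
  rewrite divr_gt0 ?mulr_gt0//= ltr_pdivrMr ?mulr_gt0// mul1r /c.
  by have := normr_ge0 (y - x); lra.
rewrite normrM gtr0_norm ?divr_gt0 ?mulr_gt0//.
rewrite mulrAC ltr_pdivrMr ?mulr_gt0// ltr_pM2l// /c.
by have := normr_ge0 (y - x); lra.
Qed.

(** At x + s(y - x) close to x, convexity bounds the increment of f above by s(f y - f x), and
    differentiability bounds it below by s(l(y - x) - e). Dividing by s leaves e arbitrary. *)
Lemma convex_tangent J f x y l : is_interval J -> @convex_function R R^o J f ->
  J x -> J y -> deriv_at J f x l -> f x + l * (y - x) <= f y.
Proof.
move=> iJ cf Jx Jy df.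
have [->|yx] := eqVneq y x; first by rewrite subrr mulr0 addr0.
apply/ler_addgt0Pr => e e0.
have c0 : 0 < `|y - x| by rewrite normr_gt0 subr_eq0.
have [d d0 fd] := df (e / `|y - x|) (divr_gt0 e0 c0).
have [s /andP[s0 s1] sd] := small_step x y d0.
have s01 : 0 <= s <= 1 by rewrite !ltW.
have zx : x + s * (y - x) - x = s * (y - x) by ring.
have sy0 : s * (y - x) != 0 by rewrite mulf_neq0 ?subr_eq0// gt_eqF.
have := fd _ (itv_combo iJ Jx Jy s01); rewrite -subr_eq0 zx => /(_ sy0 sd).
rewrite normrM (gtr0_norm s0) [X in _ <= X](_ : _ = s * e); last first.
  by field; rewrite gt_eqF.
rewrite ler_norml => /andP[lo _].
have := convex_functionE cf Jy Jx s01.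
rewrite (_ : _ + (1 - s) * x = x + s * (y - x)); last by ring.
move=> hi; rewrite -(ler_pM2l s0).
lra.
Qed.

Definition tangent_in J f g := forall x y, J x -> J y -> f x + g x * (y - x) <= f y.

(** Upper semicontinuity of the slope. For fixed u > x, the tangent at y gives g y <= (f u - f y) /
    (u - y), which tends to the chord slope from x to u as y tends to x; that slope is below g x + e
    once u is close to x. If x is the right end of [J], monotonicity of g suffices. *)
Lemma tangent_upper J f g x e : is_interval J -> tangent_in J f g ->
  J x -> deriv_at J f x (g x) -> 0 < e ->
  exists2 d : R, 0 < d & forall y, J y -> `|y - x| < d -> g y < g x + e.
Proof.
move=> iJ tg Jx df e0.
have [[u0 Ju0 xu0]|noU] := pselect (exists2 u, J u & x < u); last first.
  exists 1 => // y Jy _.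
  have [xy|yx|->] := ltgtP x y; last by rewrite ltrDl.
    by case: noU; exists y.
  have := tg _ _ Jx Jy; have := tg _ _ Jy Jx; nra.
have e2 : 0 < e / 2 by rewrite divr_gt0.
have [d1 d10 fd] := df _ e2.
have [s s01 sd] := small_step x u0 d10.
pose u := x + s * (u0 - x); have ux : x < u.
  by rewrite ltrDl mulr_gt0 ?subr_gt0//; case/andP: s01.
have Ju : J u by apply: itv_combo => //; case/andP: s01 => *; rewrite !ltW.
have ux0 : 0 < u - x by rewrite subr_gt0.
have hu : f u - f x < (g x + 3 * e / 4) * (u - x).
  have := fd u Ju; rewrite gt_eqF// => /(_ isT).
  have -> : u - x = s * (u0 - x) by rewrite /u; ring.
  move=> /(_ sd); rewrite -/u -[s * _](_ : u - x = _); last by rewrite /u; ring.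
  rewrite (gtr0_norm ux0) => /(le_trans (ler_norm _)) h.
  nra.
(* [hu] leaves a slack of e / 4 * (u - x). Replacing f x by f y, and u - x by u - y, costs at most
   [eta] = e / 16 * (u - x) each. *)
pose c := `|g x + e|; have c0 : 0 <= c by exact: normr_ge0.
have c1 : 0 < c + 1 by rewrite ltr_wpDl.
pose eta := e / 16 * (u - x); have eta0 : 0 < eta by rewrite mulr_gt0// divr_gt0.
have [d2 d20 fc] := deriv_at_continuous Jx df eta0.
exists (Num.min d2 (Num.min (u - x) (eta / (c + 1)))).
  by rewrite !lt_min d20 ux0 divr_gt0// ltr_wpDl.
move=> y Jy; rewrite !lt_min => /and3P[/(fc _ Jy) fy yu].
rewrite ltr_pdivlMr// => yc.
have uy0 : 0 < u - y by have := ler_norm (y - x); lra.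
rewrite -(ltr_pM2r uy0); have := tg _ _ Jy Ju.
have := ler_norm (f x - f y); rewrite distrC.
have : (g x + e) * (y - x) <= c * `|y - x| by rewrite -normrM ler_norm.
have : c * `|y - x| <= eta by have := normr_ge0 (y - x); nra.
have : eta = e / 16 * (u - x) by [].
nra.
Qed.

(** The reflection t -> -t preserves tangency and changes the sign of the slope, so this is the
    upper bound for the reflected function. *)
Lemma tangent_lower J f g x e : is_interval J -> tangent_in J f g ->
  J x -> deriv_at J f x (g x) -> 0 < e ->
  exists2 d : R, 0 < d & forall y, J y -> `|y - x| < d -> g x - e < g y.
Proof.
move=> iJ tg Jx df e0.
have [||||d d0 gd] := @tangent_upper (fun y => J (- y)) (fun y => f (- y))
    (fun y => - g (- y)) (- x) e _ _ _ _ e0.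
- move=> y z Jy Jz t /andP[yt tz]; apply: (iJ _ _ Jz Jy).
  by rewrite !lerN2 yt tz.
- by move=> y z Jy Jz; have := tg _ _ Jy Jz; lra.
- by rewrite opprK.
- move=> r /df[d d0 fd]; exists d => // y Jy; rewrite -eqr_oppLR => yx.
  rewrite opprK -normrN opprD => yd; have := fd _ Jy yx yd.
  by rewrite -opprD mulrN mulNr.
- exists d => // y Jy yx; have := gd (- y); rewrite !opprK addrC distrC.
  by move=> /(_ Jy yx); lra.
Qed.

Lemma continuous_within_segment J g a b : is_interval J -> J a -> J b ->
  (forall x e, J x -> 0 < e ->
    exists2 d : R, 0 < d & forall y, J y -> `|y - x| < d -> `|g y - g x| < e) ->
  {within `[a, b], continuous g}.
Proof.
move=> iJ Ja Jb cg; have sJ : `[a, b]%classic `<=` J.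
  by move=> x; rewrite /= in_itv/= => /andP[ax xb]; apply: (iJ _ _ Ja Jb); rewrite ax xb.
apply/subspace_continuousP => x /sJ Jx; apply/cvgrPdist_lt => e e0.
have [d d0 gd] := cg x e Jx e0.
rewrite near_withinE; apply/nbhs_ballP; exists d => // y; rewrite /ball/= => xy.
by move=> /sJ Jy; rewrite distrC gd// distrC.
Qed.

Lemma C1co_tangent J f : is_interval J -> C1co J f ->
  tangent_in J f (derive_in J f).
Proof.
move=> iJ [cf df] x y Jx Jy; apply: (convex_tangent iJ cf Jx Jy).
by apply: derive_inP; exact: df.
Qed.

Lemma C1co_continuous J f a b : is_interval J -> C1co J f -> J a -> J b ->
  {within `[a, b], continuous f}.
Proof.
move=> iJ [_ df] Ja Jb; apply: (continuous_within_segment iJ Ja Jb) => x e Jx.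
by apply: deriv_at_continuous => //; apply: derive_inP; exact: df.
Qed.

Lemma C1co_derive_continuous J f a b : is_interval J -> C1co J f -> J a -> J b ->
  {within `[a, b], continuous (derive_in J f)}.
Proof.
move=> iJ fC Ja Jb; apply: (continuous_within_segment iJ Ja Jb) => x e Jx e0.
have tg := C1co_tangent iJ fC; have df := derive_inP (fC.2 _ Jx).
have [d1 d10 h1] := tangent_upper iJ tg Jx df e0.
have [d2 d20 h2] := tangent_lower iJ tg Jx df e0.
exists (Num.min d1 d2) => [|y Jy]; first by rewrite lt_min d10.
rewrite lt_min => /andP[/(h1 _ Jy) ? /(h2 _ Jy) ?].
by rewrite ltr_norml; apply/andP; split; lra.
Qed.

End ConvexDerivative.

(** * The real inner product, Cauchy-Schwarz and bounded operators *)

Section HilbertReal.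
Variables (R : realType) (H : completeNormedModType R[i]).
Variable dot : {dot H for Num.conj}.
Hypothesis dot_norm : forall x : H, `|x| ^+ 2 = dot x x.
Implicit Types (x y : H) (a : R) (z : R[i]) (T : H -> H).

Lemma ReD z z' : complex.Re (z + z') = complex.Re z + complex.Re z'.
Proof. by case: z z' => [? ?] []. Qed.

Lemma ImD z z' : complex.Im (z + z') = complex.Im z + complex.Im z'.
Proof. by case: z z' => [? ?] []. Qed.

Lemma ReN z : complex.Re (- z) = - complex.Re z.
Proof. by case: z. Qed.

Lemma ReZ a z : complex.Re (a%:C * z) = a * complex.Re z.
Proof. by case: z => b c /=; rewrite mul0r subr0. Qed.

Lemma real_complexM a b : (a * b)%:C = a%:C * b%:C :> R[i].
Proof. exact: rmorphM. Qed.

Lemma Re_conj z : complex.Re (Num.conj z) = complex.Re z.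
Proof. by case: z. Qed.

Lemma Im_conj z : complex.Im (Num.conj z) = - complex.Im z.
Proof. by case: z. Qed.

(* The norm and the inner product of H take values in R[i]; their real parts
   make H a real inner product space, where all estimates are carried out. *)
Definition nrm x : R := complex.Re `|x|.
Definition ip x y : R := complex.Re (dot x y).

Lemma normE x : `|x| = (nrm x)%:C.
Proof. by rewrite RRe_real// ger0_real. Qed.

Lemma nrm_ge0 x : 0 <= nrm x.
Proof. by rewrite -ler0c -normE normr_ge0. Qed.

Lemma nrmD x y : nrm (x + y) <= nrm x + nrm y.
Proof. by rewrite -lecR rmorphD/= -!normE ler_normD. Qed.

Lemma nrmN x : nrm (- x) = nrm x.
Proof. by rewrite /nrm normrN. Qed.

Lemma nrmZ a x : nrm (a%:C *: x) = `|a| * nrm x.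
Proof.
apply: complexI; rewrite -normE normrZ normE rmorphM/=; congr (_ * _).
by rewrite normc_def /= (expr0n _ 2) /= addr0 sqrtr_sqr.
Qed.

Lemma scale_realN a x : (- a)%:C *: x = - (a%:C *: x).
Proof. by rewrite rmorphN scaleNr. Qed.

Lemma nrm0 : nrm 0 = 0.
Proof. by rewrite /nrm normr0. Qed.

Lemma nrm_gt0 x : x != 0 -> 0 < nrm x.
Proof. by rewrite -ltcR -normE normr_gt0. Qed.

Lemma ipE x : ip x x = nrm x ^+ 2.
Proof. by rewrite /ip -dot_norm normE -rmorphXn/=. Qed.

Lemma ipC x y : ip x y = ip y x.
Proof. by rewrite /ip hermC expr0 mul1r Re_conj. Qed.

Lemma ipDl x y w : ip (x + y) w = ip x w + ip y w.
Proof. by rewrite /ip linearDl ReD. Qed.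

Lemma ipZl a x y : ip (a%:C *: x) y = a * ip x y.
Proof. by rewrite /ip linearZl_LR ReZ. Qed.

Lemma ipNl x y : ip (- x) y = - ip x y.
Proof. by rewrite /ip linearNl ReN. Qed.

Lemma ipDr x y w : ip w (x + y) = ip w x + ip w y.
Proof. by rewrite ipC ipDl !(ipC w). Qed.

Lemma ipZr a x y : ip y (a%:C *: x) = a * ip y x.
Proof. by rewrite ipC ipZl ipC. Qed.

Lemma linD T x y : linear T -> T (x + y) = T x + T y.
Proof. by move=> lT; have := lT 1 x y; rewrite !scale1r. Qed.

Lemma lin0 T : linear T -> T 0 = 0.
Proof. by move=> lT; apply: (addrI (T 0)); rewrite -linD// !addr0. Qed.

Lemma linZ T z x : linear T -> T (z *: x) = z *: T x.
Proof. by move=> lT; have := lT z x 0; rewrite !addr0 (lin0 lT) addr0. Qed.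

Lemma linN T x : linear T -> T (- x) = - T x.
Proof. by move=> lT; rewrite -scaleN1r linZ// scaleN1r. Qed.

Lemma linB T x y : linear T -> T (x - y) = T x - T y.
Proof. by move=> lT; rewrite linD// linN. Qed.

Lemma bounded_opP T : bounded_op T <->
  linear T /\ exists2 K : R, 0 < K & forall x, nrm (T x) <= K * nrm x.
Proof.
split=> -[lT cT]; split=> //.
  pose LT := GRing.isLinear.Build _ _ _ _ T lT.
  pose T' : {linear H -> H} := HB.pack T LT.
  have /(@continuous_linear_bounded _ _ _ 0 T')/linear_boundedP := cT 0.
  move=> /pinfty_ex_gt0[K K0 TK]; exists (complex.Re K).
    by move: K0; rewrite ltcE => /andP[].
  move=> x; have := TK x; rewrite /= !normE.
  have -> : K = (complex.Re K)%:C by rewrite RRe_real// gtr0_real.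
  by rewrite -rmorphM lecR.
case: cT => K K0 TK.
pose LT := GRing.isLinear.Build _ _ _ _ T lT.
pose T' : {linear H -> H} := HB.pack T LT.
apply: (@bounded_linear_continuous _ _ _ T'); apply/linear_boundedP.
near=> r => x /=; apply: (@le_trans _ _ (K%:C * `|x|)).
  by rewrite !normE -rmorphM lecR.
by rewrite ler_wpM2r//; near: r; apply: nbhs_pinfty_ge; rewrite ger0_real// ler0c ltW.
Unshelve. all: by end_near. Qed.

Lemma nrm_complete (u : nat -> H) (e : nat -> R) :
  (forall d : R, 0 < d -> exists n, forall m, (n <= m)%N -> e m <= d) ->
  (forall n m, nrm (u n - u m) <= e n + e m) ->
  exists l, forall n, nrm (u n - l) <= e n.
Proof.
move=> e0 ue.
have realP (d : R[i]) : 0 < d -> 0 < complex.Re d /\ d = (complex.Re d)%:C.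
  by move=> d0; rewrite RRe_real ?gtr0_real//; move: d0; rewrite ltcE => /andP[].
have ul : cvgn u.
  apply/cauchy_cvgP/cauchy_exP => d /realP[d0 ->].
  have [n en] := e0 (complex.Re d / 3) (divr_gt0 d0 (ltr0n _ 3)).
  exists (u n); exists n => // m /= nm.
  rewrite -ball_normE /= normE ltcR (le_lt_trans (ue n m))//.
  by have := en n (leqnn n); have := en m nm; lra.
exists (limn u) => n; apply/ler_addgt0Pr => d d0.
have d2 : 0 < d / 2 by rewrite divr_gt0.
have [k ek] := e0 _ d2.
have d2C : 0 < (d / 2)%:C by rewrite ltcR.
move/cvgrPdist_lt : ul => /(_ _ d2C)[k' _ uk'].
pose m := maxn k k'.
have := uk' m (leq_maxr _ _); rewrite /= normE ltcR => h.
have := ek m (leq_maxl _ _) => h'.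
have -> : u n - limn u = (u n - u m) + - (limn u - u m).
  by rewrite opprB addrA subrK.
rewrite (le_trans (nrmD _ _))// nrmN; have := ue n m; lra.
Qed.

Lemma discriminant_le (a b c : R) : 0 <= c ->
  (forall t, 0 <= a + 2 * t * b + t ^+ 2 * c) -> b ^+ 2 <= a * c.
Proof.
rewrite le_eqVlt => /predU1P[<-|c0] h.
  have [->|b0] := eqVneq b 0; first by rewrite expr0n mulr0.
  (* With c = 0 the expression is affine in t, and this t gives it the value -1. *)
  have := h (- (a + 1) / (2 * b)).
  rewrite mulr0 addr0 (_ : 2 * _ * b = - (a + 1)); last by field.
  by lra.
have := h (- b / c).
rewrite (_ : _ + _ = (a * c - b ^+ 2) / c); last by field; rewrite gt_eqF.
by rewrite pmulr_lge0 ?invr_gt0// subr_ge0.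
Qed.

(* Cauchy-Schwarz for the semi-inner product <Dx, y> of a positive operator;
   D = id is the usual inequality. *)
Lemma pos_CauchySchwarz D x y : linear D ->
  (forall u v, ip (D u) v = ip u (D v)) -> (forall u, 0 <= ip (D u) u) ->
  ip (D x) y ^+ 2 <= ip (D x) x * ip (D y) y.
Proof.
move=> lD sD pD; apply: discriminant_le => // t.
rewrite (_ : _ + _ = ip (D (x + t%:C *: y)) (x + t%:C *: y)) ?pD//.
rewrite linD// linZ// !(ipDl, ipDr, ipZl, ipZr) [ip (D y) x]sD (ipC y).
ring.
Qed.

Lemma CauchySchwarz x y : `|ip x y| <= nrm x * nrm y.
Proof.
rewrite -ler_sqr ?nnegrE ?mulr_ge0 ?nrm_ge0// real_normK ?num_real// exprMn.
rewrite -!ipE; apply: (@pos_CauchySchwarz id) => // u.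
by rewrite ipE sqr_ge0.
Qed.

Lemma numerical_radius T : bounded_op T ->
  exists2 K : R, 0 < K & forall x, nrm x = 1 -> `|ip (T x) x| <= K.
Proof.
move=> /bounded_opP[_ [K K0 TK]]; exists K => // x x1.
by rewrite (le_trans (CauchySchwarz _ _))// x1 mulr1 -[K]mulr1 -x1 TK.
Qed.

(** Multiplying x by -i moves the imaginary part into the real part without changing the norm. *)
Lemma Im_dot_le x y : `|complex.Im (dot x y)| <= nrm x * nrm y.
Proof.
have -> : complex.Im (dot x y) = ip ((0 -i* 1) *: x) y.
  by rewrite /ip linearZl_LR/=; case: (dot x y) => a b /=; ring.
rewrite (le_trans (CauchySchwarz _ _))// ler_wpM2r ?nrm_ge0//.
rewrite /nrm normrZ (_ : `|0 -i* 1| = 1) ?mul1r//.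
by rewrite normc_def /= (expr0n _ 2) /= add0r sqrrN expr1n sqrtr1.
Qed.

(** Cauchy-Schwarz for <Du, v> at u = x, v = Dx gives |Dx|^4 <= <Dx, x> k |Dx|^2; one then divides
    by |Dx|^2. *)
Lemma pos_norm_le D k x : linear D ->
  (forall u v, ip (D u) v = ip u (D v)) -> (forall u, 0 <= ip (D u) u) ->
  (forall u, ip (D u) u <= k * nrm u ^+ 2) ->
  nrm (D x) ^+ 2 <= k * ip (D x) x.
Proof.
move=> lD sD pD Dk; have := pos_CauchySchwarz x (D x) lD sD pD.
rewrite ipE; have := Dk (D x); have := pD x.
have [->|Dx0] := eqVneq (D x) 0.
  by rewrite nrm0 expr0n /ip linear0l mulr0.
have : 0 < nrm (D x) ^+ 2 by rewrite exprn_gt0// nrm_gt0.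
set N := nrm (D x) ^+ 2 => N0 Dx k' CS.
rewrite -(ler_pM2r N0); apply: le_trans (_ : _ <= ip (D x) x * (k * N)) _.
  by rewrite -expr2 (le_trans CS)// ler_wpM2l.
by rewrite mulrCA mulrA.
Qed.

Lemma bounded_opD S T : bounded_op S -> bounded_op T ->
  bounded_op (fun x => S x + T x).
Proof.
move=> /bounded_opP[lS [K K0 SK]] /bounded_opP[lT [L L0 TL]].
apply/bounded_opP; split=> [a x y|].
  by rewrite lS lT scalerDr addrACA.
exists (K + L) => [|x]; first exact: addr_gt0.
by rewrite mulrDl (le_trans (nrmD _ _))// lerD.
Qed.

Lemma bounded_op_comp S T : bounded_op S -> bounded_op T -> bounded_op (S \o T).
Proof.
move=> [lS cS] [lT cT]; split=> [a x y /=|]; first by rewrite lT lS.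
by move=> x; apply: continuous_comp; [exact: cT|exact: cS].
Qed.

Lemma bounded_op_scale a : bounded_op (fun x : H => a%:C *: x).
Proof.
apply/bounded_opP; split=> [b x y|].
  by rewrite scalerDr !scalerA mulrC.
exists (`|a| + 1) => [|x]; first by rewrite ltr_wpDl.
by rewrite nrmZ mulrDl mul1r lerDl nrm_ge0.
Qed.

Lemma selfadjointD S T : selfadjoint dot S -> selfadjoint dot T ->
  selfadjoint dot (fun x => S x + T x).
Proof.
move=> [bS sS] [bT sT]; split=> [|x y]; first exact: bounded_opD.
by rewrite linearDl linearDr/= sS sT.
Qed.

Lemma selfadjoint_scale a : selfadjoint dot (fun x => a%:C *: x).
Proof.
split=> [|x y]; first exact: bounded_op_scale.
by rewrite linearZl_LR linearZr_LR/= conj_Creal//; apply/complex_realP; exists a.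
Qed.

(** * Polynomials of an operator *)

Section PolynomialCalculus.
Variable T : H -> H.
Hypothesis lT : linear T.
Implicit Types (P Q : {poly R[i]}) (p q : {poly R}).

(** Complex coefficients, because a real polynomial splits into linear factors only over R[i]. *)
Definition cpoly_op P x := \sum_(i < size P) P`_i *: iter i T x.

Lemma cpoly_opE n P x : (size P <= n)%N ->
  cpoly_op P x = \sum_(i < n) P`_i *: iter i T x.
Proof.
move=> Pn; rewrite /cpoly_op (big_ord_widen n (fun i => P`_i *: iter i T x))//.
rewrite [RHS](bigID (fun i : 'I_n => (i < size P)%N))/= [X in _ = _ + X]big1 ?addr0//.
by move=> i; rewrite -leqNgt => Pi; rewrite nth_default// scale0r.
Qed.

Lemma cpoly_opD P Q x : cpoly_op (P + Q) x = cpoly_op P x + cpoly_op Q x.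
Proof.
pose n := maxn (size P) (size Q).
rewrite !(@cpoly_opE n) ?leq_maxl ?leq_maxr ?size_polyD// -big_split/=.
by apply: eq_bigr => i _; rewrite coefD scalerDl.
Qed.

Lemma cpoly_opZ z P x : cpoly_op (z *: P) x = z *: cpoly_op P x.
Proof.
rewrite (@cpoly_opE (size P)) ?size_scale_leq// /cpoly_op scaler_sumr.
by apply: eq_bigr => i _; rewrite coefZ scalerA.
Qed.

Lemma cpoly_opC z x : cpoly_op z%:P x = z *: x.
Proof.
by rewrite (@cpoly_opE 1) ?size_polyC_leq1// big_ord1 coefC.
Qed.

Lemma cpoly_opMX P x : cpoly_op (P * 'X) x = T (cpoly_op P x).
Proof.
rewrite (@cpoly_opE (size P).+1); last first.
  by rewrite (leq_trans (size_polyMleq _ _))// size_polyX addn2.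
rewrite big_ord_recl coefMX/= scale0r add0r /cpoly_op.
rewrite (big_morph T (fun x y => linD x y lT) (lin0 lT)).
by apply: eq_bigr => i _; rewrite coefMX/= linZ.
Qed.

Lemma cpoly_opM P Q x : cpoly_op (P * Q) x = cpoly_op P (cpoly_op Q x).
Proof.
elim/poly_ind: P => [|P c IHP].
  by rewrite mul0r -(scale0r (1 : {poly R[i]})) !cpoly_opZ !scale0r.
rewrite mulrDl -mulrA (mulrC 'X) mulrA mul_polyC !cpoly_opD !cpoly_opMX IHP.
by rewrite cpoly_opZ cpoly_opC.
Qed.

Local Notation pop p := (poly_op p T).
Local Notation toC := (map_poly (real_complex R)).

Lemma poly_op_cpoly p x : pop p x = cpoly_op (toC p) x.
Proof.
rewrite /poly_op /cpoly_op size_map_poly.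
by apply: eq_bigr => i _; rewrite coef_map.
Qed.

Lemma poly_opD p q x : pop (p + q) x = pop p x + pop q x.
Proof. by rewrite !poly_op_cpoly rmorphD cpoly_opD. Qed.

Lemma poly_opM p q x : pop (p * q) x = pop p (pop q x).
Proof. by rewrite !poly_op_cpoly rmorphM cpoly_opM. Qed.

Lemma poly_opC a x : pop a%:P x = a%:C *: x.
Proof. by rewrite poly_op_cpoly map_polyC cpoly_opC. Qed.

Lemma poly_opX x : pop 'X x = T x.
Proof.
by rewrite poly_op_cpoly map_polyX -[ 'X]mul1r cpoly_opMX cpoly_opC scale1r.
Qed.

Lemma poly_opN p x : pop (- p) x = - pop p x.
Proof.
by rewrite -mulN1r -polyCN poly_opM poly_opC rmorphN1 scaleN1r.
Qed.

Lemma poly_opB p q x : pop (p - q) x = pop p x - pop q x.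
Proof. by rewrite poly_opD poly_opN. Qed.

Lemma poly_op_ind (A : (H -> H) -> Prop) :
  (forall a, A (fun x => a%:C *: x)) ->
  (forall S S', A S -> A S' -> A (fun x => S x + S' x)) ->
  (forall S, A S -> A (S \o T)) -> forall p, A (pop p).
Proof.
move=> Ac AD AT; elim/poly_ind => [|p c IHp].
  rewrite (_ : pop 0 = fun x => 0%:C *: x)//.
  by apply/funext => x; rewrite -poly_opC.
rewrite (_ : pop _ = fun x => (pop p \o T) x + c%:C *: x).
  by apply: AD => //; exact: AT.
by apply/funext => x; rewrite poly_opD poly_opC poly_opM poly_opX.
Qed.

End PolynomialCalculus.

Lemma poly_op_bounded T p : bounded_op T -> bounded_op (poly_op p T).
Proof.
move=> bT; apply: poly_op_ind => [|a|S S' bS bS'|S bS]; first exact: bT.1.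
- exact: bounded_op_scale.
- exact: bounded_opD.
- exact: bounded_op_comp.
Qed.

Lemma poly_op_selfadjoint T p : selfadjoint dot T -> selfadjoint dot (poly_op p T).
Proof.
move=> sT; have lT := sT.1.1.
(* Self-adjointness alone is not inductive: S T is self-adjoint only when S and T commute. *)
pose A (S : H -> H) := selfadjoint dot S /\ forall x, S (T x) = T (S x).
suff : A (poly_op p T) by case.
apply: (poly_op_ind lT) => [a|S S' [sS cS] [sS' cS']|S [sS cS]].
- by split=> [|x]; [exact: selfadjoint_scale|rewrite linZ].
- by split=> [|x]; [exact: selfadjointD|rewrite cS cS' linD].
- split=> [|x /=]; last by rewrite cS.
  split=> [|x y /=]; first exact: bounded_op_comp sS.1 sT.1.
  by rewrite sS.2 sT.2 cS.
Qed.

(** * Bounded below operators and the minimum of the numerical range *)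

Definition bounded_below T := exists2 k : R, 0 < k & forall x, k * nrm x <= nrm (T x).

Lemma bounded_below_comp S T : bounded_below S -> bounded_below T ->
  bounded_below (S \o T).
Proof.
move=> [k k0 Sk] [l l0 Tl]; exists (k * l) => [|x /=]; first exact: mulr_gt0.
by rewrite (le_trans _ (Sk _))// -mulrA ler_pM2l.
Qed.

Lemma resolvent_bounded_below T z : ~ spectrum T z ->
  bounded_below (fun x => T x - z *: x).
Proof.
move=> /contrapT[S [/bounded_opP[_ [K K0 SK]] ST _]].
exists K^-1 => [|x]; first by rewrite invr_gt0.
by rewrite -{1}(ST x) ler_pdivrMl.
Qed.

(** P splits over R[i], each factor T - z has a bounded inverse and so is bounded below, and this
    property survives composition. *)
Lemma cpoly_bounded_below T (P : {poly R[i]}) : linear T -> P != 0 ->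
  (forall z, root P z -> ~ spectrum T z) -> bounded_below (cpoly_op T P).
Proof.
move=> lT P0; have [r Pr] := closed_field_poly_normal P.
have rP z : z \in r -> root P z.
  by move=> zr; rewrite Pr rootZ ?lead_coef_eq0// root_prod_XsubC.
move=> rT; have {rP}rT z : z \in r -> ~ spectrum T z by move=> /rP /rT.
have c0 : lead_coef P != 0 by rewrite lead_coef_eq0.
rewrite Pr; move: (lead_coef P) c0 => c c0 {P P0 Pr}.
elim: r rT => [|z r IHr] rT.
  have cE : (complex.Re `|c|)%:C = `|c| by rewrite RRe_real// ger0_real.
  rewrite big_nil; exists (complex.Re `|c|); first by rewrite -ltcR cE normr_gt0.
  move=> x; rewrite -mul_polyC mulr1 cpoly_opC -lecR.
  by rewrite real_complexM cE -!normE normrZ.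
have {}IHr := IHr (fun z' z'r => rT z' (mem_behead (s := z :: r) z'r)).
rewrite big_cons mulrC scalerAl.
rewrite (_ : cpoly_op _ _ = cpoly_op T (c *: (\prod_(j <- r) ('X - j%:P)))
    \o (fun x => T x - z *: x)).
  apply: bounded_below_comp IHr _; apply: resolvent_bounded_below.
  by apply: rT; rewrite mem_head.
apply/funext => x; rewrite cpoly_opM//=; congr (cpoly_op _ _ _).
rewrite -polyCN cpoly_opD cpoly_opC scaleNr; congr (_ - _).
by rewrite -['X]mul1r cpoly_opMX// cpoly_opC scale1r.
Qed.

Lemma numerical_range_inf T (x0 : H) : nrm x0 = 1 -> bounded_op T ->
  exists m : R, (forall x, m * nrm x ^+ 2 <= ip (T x) x) /\
    (forall e : R, 0 < e -> exists2 x, nrm x = 1 & ip (T x) x < m + e).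
Proof.
move=> x01 /bounded_opP[lT [K K0 TK]].
pose A := [set ip (T x) x | x in [set x | nrm x = 1]].
have Alb x : nrm x = 1 -> - K <= ip (T x) x.
  move=> x1; have := CauchySchwarz (T x) x; rewrite x1 mulr1 ler_norml.
  by move=> /andP[h _]; have := TK x; rewrite x1 mulr1; lra.
have hA : has_inf A.
  split; first by exists (ip (T x0) x0), x0.
  by exists (- K) => _ [x /= x1 <-]; exact: Alb.
exists (inf A); split=> [x|e e0].
  have [->|x0'] := eqVneq x 0; first by rewrite nrm0 expr0n mulr0 lin0// /ip linear0l.
  have nx := nrm_gt0 x0'.
  pose y := (nrm x)^-1%:C *: x.
  have y1 : nrm y = 1 by rewrite nrmZ gtr0_norm ?invr_gt0// mulVf ?gt_eqF.
  have : inf A <= ip (T y) y by apply: ge_inf; [exact: hA.2|exists y].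
  rewrite /y linZ// ipZl ipZr mulrA -expr2 -ler_pdivrMl ?exprn_gt0 ?invr_gt0//.
  by rewrite exprVn invrK mulrC.
have [_ [x x1 <-] xe] := inf_adherent e0 hA.
by exists x.
Qed.

(* p(T) - m is a positive operator that is not bounded below, so one of its
   linear factors T - z is not bounded below either. *)
Lemma min_poly_op T p (x0 : H) : nrm x0 = 1 -> selfadjoint dot T ->
  exists m : R, (forall x, m * nrm x ^+ 2 <= ip (poly_op p T x) x) /\
   (p = m%:P \/ exists2 z, spectrum T z & (map_poly (real_complex R) p).[z] = m%:C).
Proof.
move=> x01 sT; have lT := sT.1.1.
have [m [mlb minf]] := numerical_range_inf x01 (poly_op_bounded p sT.1).
(* For constant p the difference p - m vanishes and cannot be factored. *)
exists m; split=> //; have [pm|pm] := eqVneq p m%:P; [by left|right].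
apply: contrapT => noz.
pose q := p - m%:P; have q0 : q != 0 by rewrite subr_eq0.
have sD := poly_op_selfadjoint q sT.
have bb : bounded_below (poly_op q T).
  rewrite (_ : poly_op q T = cpoly_op T (map_poly (real_complex R) q)).
    apply: cpoly_bounded_below => //; first by rewrite map_poly_eq0.
    move=> z; rewrite rmorphB/= map_polyC => /rootP qz Tz; apply: noz; exists z => //.
    by move: qz; rewrite hornerD hornerN hornerC => /eqP; rewrite subr_eq0 => /eqP.
  by apply/funext => x; rewrite poly_op_cpoly.
have DE x : ip (poly_op q T x) x = ip (poly_op p T x) x - m * nrm x ^+ 2.
  by rewrite poly_opB// poly_opC// ipDl ipNl ipZl ipE.
have [k k0 Dk] := bb.
have /bounded_opP[lD [K K0 DK]] := sD.1.
have DKx x : ip (poly_op q T x) x <= K * nrm x ^+ 2.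
  rewrite (le_trans (ler_norm _))// (le_trans (CauchySchwarz _ _))//.
  by rewrite expr2 mulrA ler_wpM2r ?nrm_ge0.
(* Then |q(T)x|^2 <= K <q(T)x, x> < k^2, against the lower bound k on |q(T)x|. *)
have [x x1 xe] := minf (k ^+ 2 / K) (divr_gt0 (exprn_gt0 _ k0) K0).
have Dpos u : 0 <= ip (poly_op q T u) u by rewrite DE subr_ge0.
have Dsym u v : ip (poly_op q T u) v = ip u (poly_op q T v) by rewrite /ip sD.2.
have := pos_norm_le x lD Dsym Dpos DKx.
rewrite DE x1 expr1n mulr1; apply/negP; rewrite -ltNge.
have kD : k ^+ 2 <= nrm (poly_op q T x) ^+ 2.
  by have := Dk x; rewrite x1 mulr1 => kx; rewrite ler_sqr ?nnegrE ?nrm_ge0// ltW.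
by rewrite (lt_le_trans _ kD)// -ltr_pdivlMl// mulrC; lra.
Qed.

(** * Inverting a strictly positive operator *)

Lemma geometric_small (C q d : R) : 0 <= C -> 0 <= q -> q < 1 -> 0 < d ->
  exists n, forall m, (n <= m)%N -> C * q ^+ m <= d.
Proof.
move=> C0 q0 q1 d0; have : `|q| < 1 by rewrite ger0_norm.
move=> /(@cvg_geometric _ C)/cvgrPdist_lt/(_ d d0)[n _ nd]; exists n => m nm.
by have := nd m nm; rewrite /= sub0r normrN => /ltW; apply: le_trans; exact: ler_norm.
Qed.

(* D x = y is solved by iterating the contraction x |-> x - (D x - y) / b. *)
Lemma pos_invertible D (a : R) : selfadjoint dot D -> 0 < a ->
  (forall x, a * nrm x ^+ 2 <= ip (D x) x) ->
  exists S, [/\ bounded_op S, forall x, S (D x) = x & forall x, D (S x) = x].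
Proof.
move=> sD a0 aD; have /bounded_opP[lD [K K0 DK]] := sD.1.
have Dbb x : a * nrm x <= nrm (D x).
  have [->|/nrm_gt0 x0] := eqVneq x 0; first by rewrite nrm0 mulr0 nrm_ge0.
  rewrite -(ler_pM2r x0) -mulrA -expr2 (le_trans (aD x))//.
  by rewrite (le_trans (ler_norm _))// CauchySchwarz.
have Dinj x y : D x = D y -> x = y.
  move=> Dxy; apply/eqP; rewrite -subr_eq0; apply: contraT => /nrm_gt0 xy0.
  by have := Dbb (x - y); rewrite linB// Dxy subrr nrm0; nra.
(* With b >= K the operator E = 1 - D / b is positive, and its form is at most q = 1 - a / b;
   [pos_norm_le] makes it a q-contraction. Adding a to K ensures q >= 0 without comparing a and
   K. *)
pose b := K + a; have b0 : 0 < b by rewrite addr_gt0.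
pose E x := x - b^-1%:C *: D x.
have lE : linear E.
  by move=> c x y; rewrite /E lD scalerBr scalerDr !scalerA (mulrC c) opprD addrACA.
have sE u v : ip (E u) v = ip u (E v).
  by rewrite /E !(ipDl, ipDr) -!scaleNr -rmorphN ipZl ipZr /ip sD.2.
have EE u : ip (E u) u = nrm u ^+ 2 - b^-1 * ip (D u) u.
  by rewrite /E ipDl ipE ipNl ipZl.
have DK2 u : ip (D u) u <= K * nrm u ^+ 2.
  rewrite (le_trans (ler_norm _))// (le_trans (CauchySchwarz _ _))//.
  by rewrite expr2 mulrA ler_wpM2r ?nrm_ge0.
have pE u : 0 <= ip (E u) u.
  rewrite EE subr_ge0 ler_pdivrMl// (le_trans (DK2 u))//.
  by rewrite ler_wpM2r ?sqr_ge0// lerDl ltW.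
pose q := 1 - b^-1 * a.
have q0 : 0 <= q by rewrite subr_ge0 ler_pdivrMl// mulr1 lerDr ltW.
have q1 : q < 1 by rewrite gtrBl mulr_gt0 ?invr_gt0.
have Eq u : ip (E u) u <= q * nrm u ^+ 2.
  rewrite EE mulrBl mul1r lerD2l lerN2 -mulrA ler_wpM2l ?invr_ge0 ?(ltW b0)//.
have nE u : nrm (E u) <= q * nrm u.
  rewrite -ler_sqr ?nnegrE ?mulr_ge0 ?nrm_ge0// (le_trans (pos_norm_le _ lE sE pE Eq))//.
  by rewrite exprMn expr2 -mulrA ler_wpM2l.
have Dsurj y : exists x, D x = y.
  pose w := b^-1%:C *: y.
  pose u n := iter n (fun x => E x + w) 0.
  (* The fixed point of c -> q c + |w|: it bounds every iterate, hence C q^n bounds the distance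
     from the n-th iterate to all later ones. *)
  pose C := nrm w / (1 - q).
  have C0 : 0 <= C by rewrite divr_ge0 ?nrm_ge0// subr_ge0 ltW.
  have CE : q * C + nrm w = C by rewrite /C; field; rewrite subr_eq0 gt_eqF.
  have uC n : nrm (u n) <= C.
    elim: n => [|n IHn] /=; first by rewrite nrm0.
    by rewrite (le_trans (nrmD _ _))// -[leRHS]CE lerD2r (le_trans (nE _))// ler_wpM2l.
  have ud n k : nrm (u (n + k)%N - u n) <= C * q ^+ n.
    elim: n => [|n IHn]; first by rewrite subr0 mulr1 uC.
    rewrite addSn /= opprD addrACA subrr addr0 -(linB _ _ lE).
    by rewrite (le_trans (nE _))// exprS mulrCA ler_wpM2l.
  have [l ul] : exists l, forall n, nrm (u n - l) <= C * q ^+ n.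
    apply: nrm_complete => [d d0|].
      exact: geometric_small.
    move=> n m; have [nm|/ltnW mn] := leqP n m.
      rewrite -nrmN opprB -(subnKC nm) (le_trans (ud _ _))// lerDl.
      by rewrite mulr_ge0 ?exprn_ge0.
    rewrite -(subnKC mn) (le_trans (ud _ _))// lerDr.
    by rewrite mulr_ge0 ?exprn_ge0.
  exists l; have fixl : E l + w = l.
    apply/eqP; rewrite -subr_eq0; apply: contraT => /nrm_gt0.
    suff : nrm (E l + w - l) <= 0 by move=> /le_lt_trans h /h; rewrite ltxx.
    apply/ler_addgt0Pr => d d0; rewrite add0r.
    have [n Cn] := geometric_small C0 q0 q1 (divr_gt0 d0 (ltr0n _ 2)).
    have -> : E l + w - l = - E (u n - l) + (u n.+1 - l).
      by rewrite (linB _ _ lE) /= opprB addrA addrA subrK.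
    rewrite (le_trans (nrmD _ _))// nrmN [leRHS]splitr lerD//.
      rewrite (le_trans (nE _))// (le_trans _ (Cn n _))//.
      by rewrite (le_trans _ (ul n))// ler_piMl ?nrm_ge0// ltW.
    by rewrite (le_trans (ul n.+1))// Cn.
  have bw : w = b^-1%:C *: D l.
    by rewrite -[RHS](subKr l) -/(E l) -[X in X - _]fixl addrC addKr.
  have -> : y = b%:C *: w by rewrite scalerA -real_complexM divff ?gt_eqF// scale1r.
  by rewrite bw scalerA -real_complexM divff ?gt_eqF// scale1r.
have [S DS] := choice Dsurj.
have SD x : S (D x) = x by apply: Dinj.
exists S; split=> //; apply/bounded_opP; split=> [c x y|].
  by apply: Dinj; rewrite lD !DS.
exists a^-1 => [|x]; first by rewrite invr_gt0.
by rewrite ler_pdivlMl// -{2}(DS x).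
Qed.

(** * Continuous functional calculus over a real spectrum *)

Section SpectralCalculus.
Variables (T : H -> H) (x0 : H).
Hypothesis sT : selfadjoint dot T.
Hypothesis x01 : nrm x0 = 1.
Hypothesis real_spec : forall z, spectrum T z -> exists t : R, z = t%:C.

Lemma min_poly_op_spectrum p : exists2 t : R, spectrum T t%:C &
  forall x, p.[t] * nrm x ^+ 2 <= ip (poly_op p T x) x.
Proof.
have minT q m z : (map_poly (real_complex R) q).[z] = m%:C -> spectrum T z ->
    exists2 t : R, spectrum T t%:C & q.[t] = m.
  move=> + Tz; have [t zt] := real_spec Tz; rewrite zt (horner_map (real_complex R)).
  by move=> /complexI qt; exists t => //; rewrite -zt.
have [m [mp [pm|[z Tz pz]]]] := min_poly_op p x01 sT; last first.
  by have [t Tt ptm] := minT _ _ _ pz Tz; exists t => //; rewrite ptm.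
(* A constant p holds at any spectral point, so only a nonempty spectrum is wanted; the non-constant
   polynomial X provides a point. *)
have [m' [_ [Xm|[z Tz Xz]]]] := min_poly_op 'X x01 sT.
  by have := size_polyX R; rewrite Xm size_polyC; case: eqP.
by have [t Tt _] := minT _ _ _ Xz Tz; exists t => // x; rewrite pm hornerC -pm.
Qed.

Lemma poly_op_ge0 p : (forall t : R, spectrum T t%:C -> 0 <= p.[t]) ->
  forall x, 0 <= ip (poly_op p T x) x.
Proof.
move=> p0 x; have [t Tt /(_ x)] := min_poly_op_spectrum p.
by apply: le_trans; rewrite mulr_ge0 ?p0 ?sqr_ge0.
Qed.

(* |p(T)x|^2 = <p^2(T)x, x>, so the norm bound is positivity of e^2 - p^2. *)
Lemma poly_op_norm p (e : R) : 0 <= e ->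
  (forall t : R, spectrum T t%:C -> `|p.[t]| <= e) ->
  forall x, nrm (poly_op p T x) <= e * nrm x.
Proof.
move=> e0 pe x; rewrite -ler_sqr ?nnegrE ?mulr_ge0 ?nrm_ge0//.
have lT := sT.1.1.
have q0 (t : R) : spectrum T t%:C -> 0 <= ((e ^+ 2)%:P - p * p).[t].
  move=> /pe pt; rewrite hornerD hornerC hornerN hornerM subr_ge0 -expr2.
  by rewrite -(real_normK (num_real p.[t])) ler_sqr ?nnegrE.
have := poly_op_ge0 q0 x.
rewrite poly_opB// poly_opC// poly_opM// ipDl ipNl ipZl ipE exprMn subr_ge0.
suff -> : ip (poly_op p T (poly_op p T x)) x = nrm (poly_op p T x) ^+ 2 by [].
by rewrite -ipE /ip (poly_op_selfadjoint p sT).2.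
Qed.

(** The polynomials X and -X show that the extremes of the numerical range are spectral. For t
    outside [m, M], T - t or t - T is strictly positive, hence invertible. *)
Lemma spectrum_segment : exists m M : R,
  [/\ spectrum T m%:C, spectrum T M%:C,
      forall t : R, spectrum T t%:C -> m <= t <= M &
      forall x, m * nrm x ^+ 2 <= ip (T x) x <= M * nrm x ^+ 2].
Proof.
have lT := sT.1.1.
have [m Tm mT] := min_poly_op_spectrum 'X.
have [M TM MT] := min_poly_op_spectrum (- 'X).
have {}mT x : m * nrm x ^+ 2 <= ip (T x) x.
  by have := mT x; rewrite hornerX poly_opX.
have {}MT x : ip (T x) x <= M * nrm x ^+ 2.
  by have := MT x; rewrite hornerN hornerX poly_opN// poly_opX// ipNl mulNr lerN2.
exists m, M; split=> // [t Tt|x]; last by rewrite mT MT.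
apply/andP; split; rewrite leNgt; apply/negP => tm; apply: Tt.
  have tm0 : 0 < m - t by rewrite subr_gt0.
  have [] := @pos_invertible (fun x => T x + (- t)%:C *: x) _ _ tm0.
  - by apply: selfadjointD => //; exact: selfadjoint_scale.
  - by move=> x; rewrite ipDl ipZl ipE mulrDl lerD2r.
  move=> S [bS SD DS]; exists S; split=> // x.
    by have := SD x; rewrite scale_realN.
  by have := DS x; rewrite scale_realN.
have tm0 : 0 < t - M by rewrite subr_gt0.
have [] := @pos_invertible (fun x => (- 1)%:C *: T x + t%:C *: x) _ _ tm0.
- apply: selfadjointD => //; last exact: selfadjoint_scale.
  have sN := selfadjoint_scale (- 1).
  split=> [|x y]; first exact: bounded_op_comp sN.1 sT.1.
  by rewrite sN.2 sT.2 linZ.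
- move=> x; rewrite ipDl !ipZl ipE mulN1r mulrBl; have := MT x; lra.
(* S inverts t - T, so -S inverts T - t. *)
move=> S [bS SD DS]; exists (fun x => (- 1)%:C *: S x); split.
- by apply: bounded_op_comp bS; exact: bounded_op_scale.
- move=> x; rewrite -(linZ _ _ bS.1) -[RHS]SD; congr (S _).
  by rewrite scalerBr scalerA -real_complexM mulN1r (scale_realN t) opprK.
- move=> x; rewrite linZ// -[RHS]DS scalerA (mulrC t%:C) -real_complexM.
  by rewrite mulN1r (scale_realN t) opprK.
Qed.

Lemma le0_small (a C : R) : 0 <= C -> (forall e, 0 < e -> a <= e * C) -> a <= 0.
Proof.
move=> C0 h; apply/ler_addgt0Pr => e e0; rewrite add0r.
have C1 : 0 < C + 1 by rewrite ltr_wpDl.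
rewrite (le_trans (h _ (divr_gt0 e0 C1)))// mulrAC ler_pdivrMr// ler_pM2l//.
by rewrite lerDl.
Qed.

Lemma is_cfcP f S : is_cfc T f S <-> bounded_op S /\
  forall e : R, 0 < e -> exists2 p : {poly R},
    (forall t, spectrum T t%:C -> `|p.[t] - f t| <= e) &
    (forall x, nrm (S x - poly_op p T x) <= e * nrm x).
Proof.
have nE e p x : (`|S x - poly_op p T x| <= e%:C * `|x|) =
    (nrm (S x - poly_op p T x) <= e * nrm x).
  by rewrite !normE -real_complexM lecR.
split=> -[bS aS]; split=> // e /aS[p]; last first.
  by move=> pf pS; exists p; split=> // x; rewrite nE.
by move=> [pf pS]; exists p => // x; rewrite -nE.
Qed.

(** Polynomials within 1 / (n + 1) of f on the spectrum give a Cauchy sequence by [poly_op_norm].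
    The pointwise limits keep the error e n * |x|, which makes the limit linear, bounded and a limit
    in operator norm. *)
Lemma cfc_exists f :
  (forall e : R, 0 < e -> exists p : {poly R},
    forall t, spectrum T t%:C -> `|p.[t] - f t| <= e) ->
  is_cfc T f (cfc f T).
Proof.
move=> fp; suff [S fS] : exists S, is_cfc T f S by rewrite /cfc; apply: xgetPex; exists S.
have lT := sT.1.1.
pose e (n : nat) : R := n.+1%:R^-1.
have e0 n : 0 < e n by rewrite invr_gt0.
have esmall d : 0 < d -> exists n, forall m, (n <= m)%N -> e m <= d.
  move=> d0; exists (Num.bound d^-1) => m nm.
  rewrite invf_ple ?posrE// (le_trans (ltW (archi_boundP _))) ?invr_ge0 ?ltW//.
  by rewrite ltr_nat.
have [p pf] := choice (fun n => fp (e n) (e0 n)).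
have pp n m x : nrm (poly_op (p n) T x - poly_op (p m) T x) <= (e n + e m) * nrm x.
  rewrite -poly_opB//; apply: poly_op_norm => [|t Tt]; first by rewrite addr_ge0// ltW.
  rewrite hornerD hornerN (le_trans (ler_distD (f t) _ _))// lerD ?pf//.
  by rewrite distrC pf.
have limp x : exists l, forall n, nrm (poly_op (p n) T x - l) <= e n * nrm x.
  apply: nrm_complete => [d d0|n m]; last by rewrite -mulrDl.
  have x1 : 0 < nrm x + 1 by rewrite ltr_wpDl ?nrm_ge0.
  have [n en] := esmall _ (divr_gt0 d0 x1); exists n => m /en.
  rewrite ler_pdivlMr// => h; rewrite (le_trans _ h)// ler_wpM2l ?(ltW (e0 _))//.
  by rewrite lerDl.
have [S pS] := choice limp.
have bS : bounded_op S.
  apply/bounded_opP; split=> [a x y|].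
    have nz z w : nrm (z *: w) = complex.Re `|z| * nrm w.
      by rewrite /nrm normrZ normE -[`|z|]RRe_real ?ger0_real// -real_complexM.
    apply/eqP; rewrite -subr_eq0; apply: contraT => /nrm_gt0.
    set D := S _ - _.
    have [C C0 DC] : exists2 C, 0 <= C & forall n, nrm D <= e n * C.
      exists (nrm (a *: x + y) + (complex.Re `|a| * nrm x + nrm y)) => [|n].
        by rewrite -nz !addr_ge0 ?nrm_ge0.
      have [lp _] := poly_op_bounded (p n) sT.1.
      have -> : D = - (poly_op (p n) T (a *: x + y) - S (a *: x + y)) +
          (a *: (poly_op (p n) T x - S x) + (poly_op (p n) T y - S y)).
        by rewrite lp /D scalerBr [X in _ = _ + X]addrACA -opprD opprB addrA subrK.
      rewrite (le_trans (nrmD _ _))// nrmN mulrDr lerD//.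
      rewrite (le_trans (nrmD _ _))// mulrDr lerD// nz mulrCA ler_wpM2l//.
      by rewrite -ler0c RRe_real ?ger0_real.
    have D0 : nrm D <= 0.
      apply: (le0_small C0) => d /esmall[n /(_ n (leqnn n)) nd].
      by rewrite (le_trans (DC n))// ler_wpM2r.
    by move=> /lt_le_trans /(_ D0); rewrite ltxx.
  have /bounded_opP[_ [K K0 pK]] := poly_op_bounded (p 0%N) sT.1.
  exists (e 0%N + K) => [|x]; first by rewrite addr_gt0.
  have -> : S x = - (poly_op (p 0%N) T x - S x) + poly_op (p 0%N) T x.
    by rewrite opprB subrK.
  by rewrite (le_trans (nrmD _ _))// nrmN mulrDl lerD.
exists S; apply/is_cfcP; split=> // d /esmall[n /(_ n (leqnn n)) nd].
exists (p n) => [t Tt|x]; first by rewrite (le_trans (pf n t Tt)).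
rewrite -nrmN opprB (le_trans (pS x n))// ler_wpM2r// nrm_ge0//.
Qed.

Section Algebra.
Variables (f g : R -> R) (S S' : H -> H).
Hypotheses (fS : is_cfc T f S) (gS' : is_cfc T g S').

Lemma is_cfcD : is_cfc T (fun t => f t + g t) (fun x => S x + S' x).
Proof.
move: fS gS' => /is_cfcP[bS aS] /is_cfcP[bS' aS']; apply/is_cfcP; split.
  exact: bounded_opD.
move=> e e0; have e2 : 0 < e / 2 by rewrite divr_gt0.
have [p pf pS] := aS _ e2; have [q qg qS] := aS' _ e2.
exists (p + q) => [t Tt|x].
  rewrite hornerD opprD addrACA (le_trans (ler_normD _ _))// [leRHS]splitr.
  by rewrite lerD ?pf ?qg.
rewrite poly_opD opprD addrACA (le_trans (nrmD _ _))// [e]splitr mulrDl.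
by rewrite lerD ?pS ?qS.
Qed.

Lemma is_cfcZ a : is_cfc T (fun t => a * f t) (fun x => a%:C *: S x).
Proof.
move: fS => /is_cfcP[bS aS]; apply/is_cfcP; split.
  exact: bounded_op_comp (bounded_op_scale a) bS.
move=> e e0; have a1 : 0 < `|a| + 1 by rewrite ltr_wpDl.
have ae c : 0 <= c -> `|a| * (e / (`|a| + 1) * c) <= e * c.
  move=> c0; rewrite mulrA ler_wpM2r// mulrCA ger_pMr// ler_pdivrMr// mul1r.
  by rewrite lerDl.
have [p pf pS] := aS _ (divr_gt0 e0 a1); exists (a%:P * p) => [t Tt|x].
  rewrite hornerM hornerC -mulrBr normrM (le_trans (ler_wpM2l _ (pf t Tt)))//.
  by have := ae 1 ler01; rewrite !mulr1.
rewrite poly_opM ?poly_opC; try exact: sT.1.1.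
by rewrite -scalerBr nrmZ (le_trans (ler_wpM2l _ (pS x)))// ae ?nrm_ge0.
Qed.

Lemma is_cfc_cst a : is_cfc T (fun=> a) (fun x => a%:C *: x).
Proof.
apply/is_cfcP; split=> [|e e0]; first exact: bounded_op_scale.
exists a%:P => [t _|x]; first by rewrite hornerC subrr normr0 ltW.
by rewrite poly_opC ?subrr ?nrm0 ?mulr_ge0 ?nrm_ge0 ?ltW//; exact: sT.1.1.
Qed.

Lemma is_cfcX : is_cfc T id T.
Proof.
apply/is_cfcP; split=> [|e e0]; first exact: sT.1.
exists 'X => [t _|x]; first by rewrite hornerX subrr normr0 ltW.
by rewrite poly_opX ?subrr ?nrm0 ?mulr_ge0 ?nrm_ge0 ?ltW//; exact: sT.1.1.
Qed.

Lemma is_cfcMX : is_cfc T (fun t => f t * t) (S \o T).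
Proof.
have [m [M [_ _ mM _]]] := spectrum_segment.
move: fS => /is_cfcP[bS aS]; apply/is_cfcP; split.
  exact: bounded_op_comp bS sT.1.
have /bounded_opP[lT [K K0 TK]] := sT.1.
(* One constant that bounds both |t| on the spectrum and the norm of T. *)
pose L := `|m| + `|M| + K; have L0 : 0 < L by rewrite ltr_wpDl// addr_ge0.
move=> e e0; have [p pf pS] := aS _ (divr_gt0 e0 L0).
exists (p * 'X) => [t Tt|x].
  rewrite hornerM hornerX -mulrBl normrM.
  apply: (@le_trans _ _ (e / L * L)); last by rewrite divfK// gt_eqF.
  rewrite ler_pM ?pf//; have /andP[? ?] := mM _ Tt.
  have := ler_norm M; have := ler_norm (- m); rewrite normrN => ? ?.
  by rewrite /L ler_norml; apply/andP; split; have := normr_ge0 m;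
     have := normr_ge0 M; lra.
rewrite /= poly_opM// poly_opX// (le_trans (pS _))// mulrAC ler_pdivrMr//.
rewrite -mulrA ler_wpM2l ?(ltW e0)// (le_trans (TK x))// mulrC ler_wpM2l ?nrm_ge0//.
by rewrite /L lerDr addr_ge0.
Qed.

(** An approximant p may dip to -e on the spectrum, but p + e does not become negative. The shift
    and the approximation each cost e |x|^2, whence the 2. *)
Lemma is_cfc_ge0 : (forall t : R, spectrum T t%:C -> 0 <= f t) ->
  forall x, 0 <= ip (S x) x.
Proof.
move=> f0 x; move: fS => /is_cfcP[bS aS].
rewrite -oppr_le0; apply: (@le0_small _ (2 * nrm x ^+ 2)).
  by rewrite mulr_ge0 ?sqr_ge0.
move=> e e0; have [p pf pS] := aS e e0.
have lT := sT.1.1.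
have q0 (t : R) : spectrum T t%:C -> 0 <= (p + e%:P).[t].
  move=> Tt; have := pf t Tt; have := f0 t Tt; rewrite hornerD hornerC.
  by rewrite ler_norml => ? /andP[? _]; lra.
have := poly_op_ge0 q0 x; rewrite poly_opD poly_opC// ipDl ipZl ipE => h.
have := CauchySchwarz (S x - poly_op p T x) x; rewrite ipDl ipNl ler_norml.
have := ler_wpM2r (nrm_ge0 x) (pS x); rewrite -mulrA -expr2.
by move=> ? /andP[? _]; lra.
Qed.

(** Positivity in R[i] includes being real. The forms of p(T) are real by self-adjointness, and the
    imaginary part of the limit is arbitrarily small. *)
Lemma is_cfc_real x : dot (S x) x = (ip (S x) x)%:C.
Proof.
move: fS => /is_cfcP[bS aS].
suff im0 : `|complex.Im (dot (S x) x)| <= 0.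
  rewrite /ip; move: im0; case: (dot (S x) x) => a b /=.
  by rewrite normr_le0 => /eqP ->.
apply: (@le0_small _ (nrm x ^+ 2)); first exact: sqr_ge0.
move=> e e0; have [p pf pS] := aS e e0.
have pxx : complex.Im (dot (poly_op p T x) x) = 0.
  have [_ /(_ x x)] := poly_op_selfadjoint p sT.
  move=> /(congr1 (@complex.Im R)); rewrite [in RHS]hermC expr0 mul1r Im_conj.
  by move=> ?; lra.
rewrite -(subrK (poly_op p T x) (S x)) linearDl/= ImD pxx addr0.
by rewrite (le_trans (Im_dot_le _ _))// expr2 mulrA ler_wpM2r ?nrm_ge0.
Qed.

End Algebra.

End SpectralCalculus.

End HilbertReal.

(** * Tangent inequalities transferred to operators *)

Section ConvexCalculus.
Variables (R : realType) (H : completeNormedModType R[i]).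
Variable dot : {dot H for Num.conj}.
Hypothesis dot_norm : forall x : H, `|x| ^+ 2 = dot x x.
Variables (J : set R) (T : H -> H) (x0 : H).
Hypotheses (iJ : is_interval J) (sT : selfadjoint dot T).
Hypotheses (TJ : spectrum_in T J) (x01 : nrm x0 = 1).
Implicit Types (f : R -> R) (x : H) (s t : R).

Let real_spec z : spectrum T z -> exists t : R, z = t%:C.
Proof. by move=> /TJ[t _ <-]; exists t. Qed.

Let specJ t : spectrum T t%:C -> J t.
Proof. by move=> /TJ[u Ju /complexI <-]. Qed.

Lemma is_cfc_continuous f :
  (forall a b, J a -> J b -> {within `[a, b], continuous f}) ->
  is_cfc T f (cfc f T).
Proof.
move=> cf; apply: (cfc_exists dot_norm sT x01 real_spec) => e e0.
have [m [M [Tm TM mM _]]] := spectrum_segment dot_norm sT x01 real_spec.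
have [p pf] := weierstrass_approximation (cf _ _ (specJ Tm) (specJ TM)) e0.
by exists p => t /mM tmM; apply: pf; rewrite in_itv.
Qed.

Lemma numerical_range_interval x : nrm x = 1 -> J (ip dot (T x) x).
Proof.
move=> x1; have [m [M [Tm TM _ /(_ x)]]] := spectrum_segment dot_norm sT x01 real_spec.
by rewrite x1 expr1n !mulr1; apply: iJ; exact: specJ.
Qed.

Lemma cfc_jensen f x : C1co J f -> nrm x = 1 ->
  f (ip dot (T x) x) <= ip dot (cfc f T x) x.
Proof.
move=> fC x1; set s := ip _ _ _; have Js : J s by exact: numerical_range_interval.
have fS := is_cfc_continuous (fun a b => @C1co_continuous _ _ _ a b iJ fC).
pose g := derive_in J f.
have gX := is_cfcZ sT (is_cfcX sT) (- g s).
have gc := is_cfc_cst T (g s * s - f s).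
(* The gap between f and its tangent at s; on x its linear part vanishes since <Tx, x> = s. *)
have F0 t : spectrum T t%:C -> 0 <= f t + (- g s * t + (g s * s - f s)).
  by move=> /specJ Jt; have := C1co_tangent iJ fC Js Jt; rewrite -/g; lra.
have := is_cfc_ge0 dot_norm sT x01 real_spec
  (is_cfcD fS (is_cfcD gX gc)) F0 x.
rewrite !ipDl !ipZl -/s ipE// x1 => ?; lra.
Qed.

(** Here the tangent is drawn at the spectral variable, which produces f'(T)T; s stays free in [J],
    so another operator can supply it. *)
Lemma cfc_tangent f x s : C1co J f -> nrm x = 1 -> J s ->
  ip dot (cfc f T x) x <= f s +
    (ip dot (cfc (derive_in J f) T (T x)) x -
     s * ip dot (cfc (derive_in J f) T x) x).
Proof.
move=> fC x1 Js; pose g := derive_in J f.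
have fS := is_cfc_continuous (fun a b => @C1co_continuous _ _ _ a b iJ fC).
have gS := is_cfc_continuous (fun a b => @C1co_derive_continuous _ _ _ a b iJ fC).
have fN := is_cfcZ sT fS (- 1).
have gX := is_cfcMX dot_norm sT x01 real_spec gS.
have gs := is_cfcZ sT gS (- s).
have fs := is_cfc_cst T (f s).
have F0 t : spectrum T t%:C ->
    0 <= (- 1 * f t + g t * t) + (- s * g t + f s).
  by move=> /specJ Jt; have := C1co_tangent iJ fC Jt Js; rewrite -/g; lra.
have := is_cfc_ge0 dot_norm sT x01 real_spec
  (is_cfcD (is_cfcD fN gX) (is_cfcD gs fs)) F0 x.
rewrite !ipDl !ipZl ipE// x1 /= => ?; lra.
Qed.

End ConvexCalculus.

(** * The operator inequality *)

Theorem corollary2p3 (R : realType) (H : completeNormedModType R[i])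
    (dot : {dot H for Num.conj})
    (dot_norm : forall x : H, `|x| ^+ 2 = dot x x)
    (J : set R) (J_interval : is_interval J)
    (A B : H -> H)
    (A_sa : selfadjoint dot A) (B_sa : selfadjoint dot B)
    (A_spec : spectrum_in A J) (B_spec : spectrum_in B J)
    (f : R -> R) (f_C1co : C1co J f) :
  let fA := cfc f A in
  let fB := cfc f B in
  let f'B := cfc (derive_in J f) B in
  let gamma := sup [set complex.Re
    (dot (f'B (B x)) x - dot (A x) x * dot (f'B x) x) |
    x in [set x : H | `|x| = 1]] in
  op_le dot fB (fun x => fA x + gamma%:C *: x).
Proof.
move=> fA fB f'B gamma x.
(* A nonzero x supplies the unit vector y on which the calculus depends; both sides scale by
   |x|^2. *)
have [->|/nrm_gt0 x0] := eqVneq x 0; first by rewrite linear0r.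
pose y := (nrm x)^-1%:C *: x.
have y1 : nrm y = 1 by rewrite nrmZ gtr0_norm ?invr_gt0// mulVf ?gt_eqF.
have yx : x = (nrm x)%:C *: y.
  by rewrite /y scalerA -real_complexM divff ?gt_eqF// scale1r.
have cf a b := @C1co_continuous _ _ _ a b J_interval f_C1co.
have cf' a b := @C1co_derive_continuous _ _ _ a b J_interval f_C1co.
have fAS := is_cfc_continuous dot_norm A_sa A_spec y1 cf.
have fBS := is_cfc_continuous dot_norm B_sa B_spec y1 cf.
have f'BS := is_cfc_continuous dot_norm B_sa B_spec y1 cf'.
(* As <Au, u> is real, the real part of the product in [gamma] is a product of real parts. *)
have AE u : dot (A u) u = (ip dot (A u) u)%:C.
  exact: (is_cfc_real dot_norm A_sa (is_cfcX A_sa)).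
have ReE u : complex.Re (dot (f'B (B u)) u - dot (A u) u * dot (f'B u) u) =
    ip dot (f'B (B u)) u - ip dot (A u) u * ip dot (f'B u) u.
  by rewrite AE ReD ReN ReZ.
have gamma_ge : ip dot (f'B (B y)) y - ip dot (A y) y * ip dot (f'B y) y <= gamma.
  (* [sup] dominates its set only when the set is bounded above; the numerical radii of f'(B)B, A
     and f'(B) bound it. *)
  rewrite -ReE; apply: ub_le_sup; last by exists y => //=; rewrite normE y1.
  have [K1 _ h1] := numerical_radius dot_norm (bounded_op_comp f'BS.1 B_sa.1).
  have [K2 K20 h2] := numerical_radius dot_norm A_sa.1.
  have [K3 K30 h3] := numerical_radius dot_norm f'BS.1.
  exists (K1 + K2 * K3) => _ [u /= u1 <-]; rewrite ReE.
  have {}u1 : nrm u = 1 by rewrite /nrm u1.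
  rewrite (le_trans (ler_norm _))// (le_trans (ler_normB _ _))// lerD ?h1//.
  by rewrite normrM ler_pM ?h2 ?h3.
have main : ip dot (fB y) y <= ip dot (fA y) y + gamma.
  have Js := numerical_range_interval dot_norm J_interval A_sa A_spec y1 y1.
  have := cfc_jensen dot_norm J_interval A_sa A_spec y1 f_C1co y1.
  have := cfc_tangent dot_norm J_interval B_sa B_spec y1 f_C1co y1 Js.
  by move: gamma_ge; rewrite /fA /fB /f'B; lra.
have scale S : linear S -> ip dot (S x) x = nrm x ^+ 2 * ip dot (S y) y.
  by move=> lS; rewrite yx linZ// ipZl ipZr mulrA -yx.
have -> : dot (fA x + gamma%:C *: x - fB x) x =
    (nrm x ^+ 2 * (ip dot (fA y) y + gamma - ip dot (fB y) y))%:C.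
  rewrite linearBl linearDl/= (is_cfc_real dot_norm A_sa fAS).
  rewrite (is_cfc_real dot_norm B_sa fBS) (is_cfc_real dot_norm A_sa (is_cfc_cst A gamma)).
  rewrite ipZl ipE// (scale _ fAS.1.1) (scale _ fBS.1.1).
  by rewrite -rmorphD -rmorphB/=; congr (_%:C); rewrite /fA /fB; ring.
by rewrite ler0c mulr_ge0 ?sqr_ge0// subr_ge0.
Qed.
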